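(* There exists a tensor representable monoidal category that is not rigid.
   Context: A monoidal category $\mathscr{C}$ is right tensor representable if for every $x\in\mathscr{C}$ there is an object $Rx\in\mathscr{C}$ such that the functor $x\otimes -\colon\mathscr{C}\to\mathscr{C}$ is left adjoint to $Rx\otimes -$. It is left tensor representable if for every $x\in\mathscr{C}$ there is an object $Lx$ such that $-\otimes x$ is left adjoint to $-\otimes Lx$. It is tensor representable if it is both left and right tensor representable (no compatibility of the adjunction units and counits with the tensor product is required). A monoidal category is rigid if every object has a left and a right dual, i.e. evaluation and coevaluation morphisms satisfying the snake identities. *)

(* Defs.v *)
Set Implicit Arguments.
Unset Strict Implicit.
Unset Printing Implicit Defensive.

Declare Scope cat_scope.
Delimit Scope cat_scope with cat.
Open Scope cat_scope.

Reserved Notation "g ∘ f" (at level 40, left associativity).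
Reserved Notation "x ⊗ y" (at level 35, right associativity).
Reserved Notation "f ⊗ₘ g" (at level 35, right associativity).

Record Category := {
  ob :> Type;
  hom : ob -> ob -> Type;
  id : forall x, hom x x;
  comp : forall x y z, hom y z -> hom x y -> hom x z;
  comp_id_l : forall x y (f : hom x y), comp (id y) f = f;
  comp_id_r : forall x y (f : hom x y), comp f (id x) = f;
  comp_assoc : forall w x y z (h : hom y z) (g : hom x y) (f : hom w x),
    comp h (comp g f) = comp (comp h g) f
}.
Arguments hom {c} x y.
Arguments id {c} x.
Arguments comp {c x y z} g f.
Notation "g ∘ f" := (comp g f) : cat_scope.

Record Iso (C : Category) (x y : C) := {
  iso_hom : hom x y;
  iso_inv : hom y x;
  iso_hom_inv : iso_inv ∘ iso_hom = id x;
  iso_inv_hom : iso_hom ∘ iso_inv = id y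
}.
Arguments iso_hom {C x y} i.
Arguments iso_inv {C x y} i.

Record Functor (C D : Category) := {
  fob :> C -> D;
  fmap : forall x y : C, hom x y -> hom (fob x) (fob y);
  fmap_id : forall x : C, fmap (id x) = id (fob x);
  fmap_comp : forall (x y z : C) (g : hom y z) (f : hom x y),
    fmap (g ∘ f) = fmap g ∘ fmap f
}.
Arguments fmap {C D} F {x y} f : rename.

Definition functor_id (C : Category) : Functor C C := {|
  fob := fun x => x;
  fmap := fun x y f => f;
  fmap_id := fun x => eq_refl;
  fmap_comp := fun x y z g f => eq_refl
|}.

Definition functor_comp (C D E : Category) (G : Functor D E) (F : Functor C D) :
  Functor C E.
Proof.
refine {| fob := fun x => G (F x); fmap := fun x y f => fmap G (fmap F f) |}.
- intros x. rewrite fmap_id. apply fmap_id.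
- intros x y z g f. rewrite fmap_comp. apply fmap_comp.
Defined.

Record NatTrans (C D : Category) (F G : Functor C D) := {
  component :> forall x : C, hom (F x) (G x);
  naturality : forall (x y : C) (f : hom x y),
    component y ∘ fmap F f = fmap G f ∘ component x
}.

Definition left_adjoint_to (C D : Category) (F : Functor C D) (G : Functor D C) :
  Prop :=
  exists (unit : NatTrans (functor_id C) (functor_comp G F))
         (counit : NatTrans (functor_comp F G) (functor_id D)),
    (forall x : C, counit (F x) ∘ fmap F (unit x) = id (F x)) /\
    (forall y : D, fmap G (counit y) ∘ unit (G y) = id (G y)).

Record MonoidalCategory := {
  carrier :> Category;

  tensor_ob : carrier -> carrier -> carrier
    where "x ⊗ y" := (tensor_ob x y);
  tensor_hom : forall x x' y y' : carrier,
    hom x x' -> hom y y' -> hom (x ⊗ y) (x' ⊗ y')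
    where "f ⊗ₘ g" := (tensor_hom f g);
  tensor_id : forall x y : carrier, id x ⊗ₘ id y = id (x ⊗ y);
  tensor_comp : forall (x x' x'' y y' y'' : carrier)
    (f' : hom x' x'') (f : hom x x') (g' : hom y' y'') (g : hom y y'),
    (f' ∘ f) ⊗ₘ (g' ∘ g) = (f' ⊗ₘ g') ∘ (f ⊗ₘ g);

  one : carrier;

  assoc : forall x y z : carrier, Iso ((x ⊗ y) ⊗ z) (x ⊗ (y ⊗ z));
  assoc_natural : forall (x x' y y' z z' : carrier)
    (f : hom x x') (g : hom y y') (h : hom z z'),
    iso_hom (assoc x' y' z') ∘ ((f ⊗ₘ g) ⊗ₘ h) =
    (f ⊗ₘ (g ⊗ₘ h)) ∘ iso_hom (assoc x y z);

  lunit : forall x : carrier, Iso (one ⊗ x) x;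
  lunit_natural : forall (x x' : carrier) (f : hom x x'),
    iso_hom (lunit x') ∘ (id one ⊗ₘ f) = f ∘ iso_hom (lunit x);

  runit : forall x : carrier, Iso (x ⊗ one) x;
  runit_natural : forall (x x' : carrier) (f : hom x x'),
    iso_hom (runit x') ∘ (f ⊗ₘ id one) = f ∘ iso_hom (runit x);

  triangle : forall x y : carrier,
    (id x ⊗ₘ iso_hom (lunit y)) ∘ iso_hom (assoc x one y) =
    iso_hom (runit x) ⊗ₘ id y;
  pentagon : forall w x y z : carrier,
    iso_hom (assoc w x (y ⊗ z)) ∘ iso_hom (assoc (w ⊗ x) y z) =
    (id w ⊗ₘ iso_hom (assoc x y z)) ∘ iso_hom (assoc w (x ⊗ y) z)
      ∘ (iso_hom (assoc w x y) ⊗ₘ id z)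
}.
Arguments tensor_ob {m} x y.
Arguments tensor_hom {m x x' y y'} f g.
Arguments one {m}.
Arguments assoc {m} x y z.
Arguments lunit {m} x.
Arguments runit {m} x.
Notation "x ⊗ y" := (tensor_ob x y) : cat_scope.
Notation "f ⊗ₘ g" := (tensor_hom f g) : cat_scope.

(* The functor x ⊗ -. *)
Definition tensor_left (C : MonoidalCategory) (x : C) : Functor C C.
Proof.
refine {| fob := fun a : C => x ⊗ a; fmap := fun a b f => id x ⊗ₘ f |}.
- intros a. apply tensor_id.
- intros a b c g f. rewrite <- tensor_comp, comp_id_l. reflexivity.
Defined.

(* The functor - ⊗ x. *)
Definition tensor_right (C : MonoidalCategory) (x : C) : Functor C C.
Proof.
refine {| fob := fun a : C => a ⊗ x; fmap := fun a b f => f ⊗ₘ id x |}.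
- intros a. apply tensor_id.
- intros a b c g f. rewrite <- tensor_comp, comp_id_l. reflexivity.
Defined.

Definition right_tensor_representable (C : MonoidalCategory) : Prop :=
  forall x : C, exists Rx : C, left_adjoint_to (tensor_left x) (tensor_left Rx).

Definition left_tensor_representable (C : MonoidalCategory) : Prop :=
  forall x : C, exists Lx : C, left_adjoint_to (tensor_right x) (tensor_right Lx).

Definition tensor_representable (C : MonoidalCategory) : Prop :=
  left_tensor_representable C /\ right_tensor_representable C.

(* x is a left dual of y, equivalently y is a right dual of x; the handedness
   matches tensor representability: then x ⊗ - is left adjoint to y ⊗ - and
   - ⊗ y is left adjoint to - ⊗ x. *)
Definition dual_pair (C : MonoidalCategory) (x y : C) : Prop :=
  exists (ev : hom (x ⊗ y) one) (coev : hom one (y ⊗ x)),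
    iso_hom (lunit x) ∘ (ev ⊗ₘ id x) ∘ iso_inv (assoc x y x)
      ∘ (id x ⊗ₘ coev) ∘ iso_inv (runit x) = id x /\
    iso_hom (runit y) ∘ (id y ⊗ₘ ev) ∘ iso_hom (assoc y x y)
      ∘ (coev ⊗ₘ id y) ∘ iso_inv (lunit y) = id y.

Definition rigid (C : MonoidalCategory) : Prop :=
  forall x : C,
    (exists y : C, dual_pair y x) /\ (exists y : C, dual_pair x y).

(* Main.v *)
Require Import Defs.
From Stdlib Require Import List Lia PeanoNat FunctionalExtensionality
  PropExtensionality ProofIrrelevance.
Import ListNotations.

(** The example consists of the tensor powers of the two-element crystal of sl2, the
    limit at q = 0 of the two-dimensional representation of quantum sl2. The object
    [n] stands for the set of words of [n] brackets, and the tensor product is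
    concatenation. After cancelling matched pairs, a word has [i] closing and then
    [j] opening brackets left; [(i, j)] is its weight. Words with the same matched
    positions form a component, and a component with [k] unmatched brackets contains
    exactly one word of each weight [(i, j)] with [i + j = k]. So components behave
    like irreducible representations of dimension [k + 1]. Morphisms are the
    relations that preserve weights and relate whole components; they are closed
    under composition and concatenation.

    Let [x] be the object of single brackets. A bracket put in front of a component
    with [k] unmatched brackets gives one component with [k + 1] of them and, if
    [k > 0], one with [k - 1]. Components of tensor powers of [x] are thus walks on
    the half-line graph of natural numbers, and [x ⊗ -] appends a step. Since the
    graph is undirected, [x ⊗ -] is left adjoint to itself: the unit [insert_pair]
    appends all walks [k, k ± 1, k], the counit deletes such a return walk, and the
    snake identities hold because a return walk ends with its first step reversed.
    The mirror symmetry of bracket words gives the same for [- ⊗ x], and adjoints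
    for the other tensor powers are composites of these
    ([tensor_left_tensor_adjoint], [tensor_right_tensor_adjoint]).

    These units are natural but they are not tensor products of a coevaluation with
    an identity: which brackets may be put in front of a word depends on that word.
    In fact [x] has no right dual [n]. By the snake identity, some word of [n + 1]
    brackets without unmatched ones, a value of the coevaluation [1 -> n ⊗ x], would
    have to end with an opening bracket ([crystal_not_rigid]). *)

(** * Adjunctions: composition, transport, tensor products *)

(** Spells out naturality and the snake identities without the composite and
    identity functors, whose action is only convertible to the expected one and
    would block rewriting. *)
Lemma left_adjoint_toE (C D : Category) (F : Functor C D) (G : Functor D C) :
  left_adjoint_to F G <->
  exists (u : forall x : C, hom x (G (F x))) (c : forall y : D, hom (F (G y)) y),
    (forall (x y : C) (f : hom x y), u y ∘ f = fmap G (fmap F f) ∘ u x) /\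
    (forall (x y : D) (f : hom x y), c y ∘ fmap F (fmap G f) = f ∘ c x) /\
    (forall x : C, c (F x) ∘ fmap F (u x) = id (F x)) /\
    (forall y : D, fmap G (c y) ∘ u (G y) = id (G y)).
Proof.
  split.
  - intros (u & c & Hl & Hr). exists u, c. repeat split; auto.
    + exact (fun x y f => naturality u f).
    + exact (fun x y f => naturality c f).
  - intros (u & c & Nu & Nc & Hl & Hr).
    exists (@Build_NatTrans _ _ (functor_id C) (functor_comp G F) u Nu).
    exists (@Build_NatTrans _ _ (functor_comp F G) (functor_id D) c Nc).
    split; [exact Hl|exact Hr].
Qed.

Lemma left_adjoint_to_id {C : Category} :
  left_adjoint_to (functor_id C) (functor_id C).
Proof.
  apply left_adjoint_toE. simpl.
  exists (fun x => id x), (fun x => id x).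
  repeat split; intros; now rewrite ?comp_id_l, ?comp_id_r.
Qed.

Lemma left_adjoint_to_comp {C D E : Category} {F : Functor C D} {G : Functor D C}
    {F' : Functor D E} {G' : Functor E D} :
  left_adjoint_to F G -> left_adjoint_to F' G' ->
  left_adjoint_to (functor_comp F' F) (functor_comp G G').
Proof.
  rewrite !left_adjoint_toE. simpl.
  intros (u & c & Nu & Nc & Hl & Hr) (u' & c' & Nu' & Nc' & Hl' & Hr').
  exists (fun x => fmap G (u' (F x)) ∘ u x), (fun z => c' z ∘ fmap F' (c (G' z))).
  repeat split.
  - intros x y f.
    now rewrite <- comp_assoc, Nu, !comp_assoc, <- !fmap_comp, Nu'.
  - intros x y f.
    now rewrite <- comp_assoc, <- fmap_comp, Nc, fmap_comp, !comp_assoc, Nc'.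
  - intros x.
    now rewrite <- comp_assoc, <- fmap_comp, (fmap_comp F), (comp_assoc (c _)), Nc,
      <- comp_assoc, Hl, comp_id_r.
  - intros z.
    rewrite comp_assoc, <- fmap_comp, (fmap_comp G'), <- comp_assoc, <- Nu'.
    now rewrite (comp_assoc _ (u' _)), Hr', comp_id_l.
Qed.

Lemma iso_inv_natural {C D : Category} (F F' : Functor C D)
    (a : forall x, Iso (F x) (F' x)) :
  (forall (x y : C) (f : hom x y),
     iso_hom (a y) ∘ fmap F f = fmap F' f ∘ iso_hom (a x)) ->
  forall (x y : C) (f : hom x y),
    iso_inv (a y) ∘ fmap F' f = fmap F f ∘ iso_inv (a x).
Proof.
  intros Na x y f.
  now rewrite <- (comp_id_r (_ ∘ fmap F' f)), <- (iso_inv_hom (a x)), comp_assoc,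
    <- (comp_assoc _ (fmap F' f)), <- Na, comp_assoc, iso_hom_inv, comp_id_l.
Qed.

(** Both functors are replaced at once: the unit and the counit are conjugated by
    the two isomorphisms. *)
Lemma left_adjoint_to_iso {C D : Category} {F : Functor C D} (F' : Functor C D)
    {G : Functor D C} (G' : Functor D C)
    (a : forall x, Iso (F x) (F' x)) (b : forall y, Iso (G y) (G' y)) :
  (forall (x y : C) (f : hom x y),
     iso_hom (a y) ∘ fmap F f = fmap F' f ∘ iso_hom (a x)) ->
  (forall (x y : D) (f : hom x y),
     iso_hom (b y) ∘ fmap G f = fmap G' f ∘ iso_hom (b x)) ->
  left_adjoint_to F G -> left_adjoint_to F' G'.
Proof.
  intros Na Nb.
  pose proof (iso_inv_natural F F' a Na) as Na'.
  pose proof (iso_inv_natural G G' b Nb) as Nb'.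
  rewrite !left_adjoint_toE. intros (u & c & Nu & Nc & Hl & Hr).
  exists (fun x => iso_hom (b (F' x)) ∘ (fmap G (iso_hom (a x)) ∘ u x)),
    (fun y => c y ∘ (fmap F (iso_inv (b y)) ∘ iso_inv (a (G' y)))).
  repeat split.
  - intros x y f.
    rewrite <- !comp_assoc, Nu, (comp_assoc (fmap G (iso_hom _))), <- fmap_comp, Na.
    now rewrite fmap_comp, <- comp_assoc, !comp_assoc, Nb.
  - intros x y f.
    rewrite <- !comp_assoc, Na', (comp_assoc (fmap F (iso_inv _))), <- fmap_comp, Nb'.
    now rewrite fmap_comp, !comp_assoc, Nc.
  - intros x.
    rewrite <- !comp_assoc, Na', (comp_assoc (fmap F (iso_inv _))), <- fmap_comp.
    rewrite (comp_assoc (iso_inv _)), iso_hom_inv, comp_id_l, fmap_comp.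
    rewrite !comp_assoc, Nc, <- (comp_assoc _ (c _)), Hl, comp_id_r.
    apply iso_inv_hom.
  - intros y.
    rewrite !comp_assoc, <- Nb, <- !comp_assoc, (comp_assoc (fmap G (_ ∘ _))).
    rewrite <- fmap_comp, <- !comp_assoc, iso_hom_inv, comp_id_r.
    rewrite fmap_comp, <- comp_assoc, <- Nu, (comp_assoc (fmap G _)), Hr, comp_id_l.
    apply iso_inv_hom.
Qed.

Definition iso_sym {C : Category} {x y : C} (i : Iso x y) : Iso y x :=
  {| iso_hom := iso_inv i; iso_inv := iso_hom i;
     iso_hom_inv := iso_inv_hom i; iso_inv_hom := iso_hom_inv i |}.

Lemma tensor_left_one_adjoint (C : MonoidalCategory) :
  left_adjoint_to (tensor_left (@one C)) (tensor_left one).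
Proof.
  assert (N := iso_inv_natural (tensor_left one) (functor_id C) lunit
                 (@lunit_natural C)).
  exact (@left_adjoint_to_iso _ _ (functor_id C) (tensor_left one) (functor_id C)
           (tensor_left one) (fun x => iso_sym (lunit x)) (fun x => iso_sym (lunit x))
           N N left_adjoint_to_id).
Qed.

Lemma tensor_right_one_adjoint (C : MonoidalCategory) :
  left_adjoint_to (tensor_right (@one C)) (tensor_right one).
Proof.
  assert (N := iso_inv_natural (tensor_right one) (functor_id C) runit
                 (@runit_natural C)).
  exact (@left_adjoint_to_iso _ _ (functor_id C) (tensor_right one) (functor_id C)
           (tensor_right one) (fun x => iso_sym (runit x)) (fun x => iso_sym (runit x))
           N N left_adjoint_to_id).
Qed.

(** The functor [(x ⊗ y) ⊗ -] is the composite of [y ⊗ -] and [x ⊗ -] up to the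
    associator, and adjoints of composites compose in the opposite order. Hence it
    is enough to find adjoints for objects that generate under [⊗]. *)
Lemma tensor_left_tensor_adjoint {C : MonoidalCategory} {x x' y y' : C} :
  left_adjoint_to (tensor_left x) (tensor_left x') ->
  left_adjoint_to (tensor_left y) (tensor_left y') ->
  left_adjoint_to (tensor_left (x ⊗ y)) (tensor_left (y' ⊗ x')).
Proof.
  assert (N : forall (p q a b : C) (f : hom a b),
            iso_inv (assoc p q b) ∘ (id p ⊗ₘ (id q ⊗ₘ f)) =
            (id (p ⊗ q) ⊗ₘ f) ∘ iso_inv (assoc p q a)).
  { intros p q.
    apply (iso_inv_natural (tensor_left (p ⊗ q))
             (functor_comp (tensor_left p) (tensor_left q)) (assoc p q)).
    intros a b f. simpl. now rewrite <- tensor_id, assoc_natural. }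
  intros Hx Hy.
  refine (@left_adjoint_to_iso _ _
            (functor_comp (tensor_left x) (tensor_left y)) (tensor_left (x ⊗ y))
            (functor_comp (tensor_left y') (tensor_left x')) (tensor_left (y' ⊗ x'))
            (fun a => iso_sym (assoc x y a)) (fun a => iso_sym (assoc y' x' a))
            _ _ (left_adjoint_to_comp Hy Hx)); intros; apply N.
Qed.

Lemma tensor_right_tensor_adjoint {C : MonoidalCategory} {x x' y y' : C} :
  left_adjoint_to (tensor_right x) (tensor_right x') ->
  left_adjoint_to (tensor_right y) (tensor_right y') ->
  left_adjoint_to (tensor_right (x ⊗ y)) (tensor_right (y' ⊗ x')).
Proof.
  assert (N : forall (p q a b : C) (f : hom a b),
            iso_hom (assoc b p q) ∘ ((f ⊗ₘ id p) ⊗ₘ id q) =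
            (f ⊗ₘ id (p ⊗ q)) ∘ iso_hom (assoc a p q)).
  { intros. now rewrite <- tensor_id, assoc_natural. }
  intros Hx Hy.
  refine (@left_adjoint_to_iso _ _
            (functor_comp (tensor_right y) (tensor_right x)) (tensor_right (x ⊗ y))
            (functor_comp (tensor_right x') (tensor_right y')) (tensor_right (y' ⊗ x'))
            (fun a => assoc a x y) (fun a => assoc a y' x')
            _ _ (left_adjoint_to_comp Hx Hy)); intros; apply N.
Qed.

(** * Bracket words and their matchings *)

Inductive bracket := Open | Close.
Definition word := list bracket.

(** Reading from left to right, [Open] matches a later [Close] as usual. What
    remains of a word after cancelling matched pairs is a block of [closing u]
    closing brackets followed by a block of [opening u] opening ones. *)
Fixpoint closing (u : word) : nat :=
  match u with
  | [] => 0
  | Open :: u => pred (closing u)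
  | Close :: u => S (closing u)
  end.

Fixpoint opening (u : word) : nat :=
  match u with
  | [] => 0
  | Open :: u => if closing u =? 0 then S (opening u) else opening u
  | Close :: u => opening u
  end.

Definition unmatched (u : word) : nat := closing u + opening u.

(** Putting a bracket in front of a word either leaves it unmatched, which adds one
    to the number of unmatched brackets, or matches it with the first unmatched
    [Close], which subtracts one. The numbers of unmatched brackets of all suffixes
    therefore record which positions are matched with which, and the relation says
    that these positions are the same in both words. Unmatched brackets may differ. *)
Inductive same_matching : word -> word -> Prop :=
| same_nil : same_matching [] []
| same_cons s t u v : same_matching u v -> unmatched (s :: u) = unmatched (t :: v) ->
    same_matching (s :: u) (t :: v).

Definition same_weight (u v : word) : Prop :=
  closing u = closing v /\ opening u = opening v.

Ltac weigh :=
  unfold same_weight, unmatched in *; cbn [closing opening] in *;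
  repeat match goal with
    | H : context [?n =? 0] |- _ => destruct (Nat.eqb_spec n 0)
    | |- context [?n =? 0] => destruct (Nat.eqb_spec n 0)
    end;
  try lia.

Lemma closing_app u v : closing (u ++ v) = closing u + (closing v - opening u).
Proof. induction u as [|[|] u IH]; simpl; weigh. Qed.

Lemma opening_app u v : opening (u ++ v) = opening v + (opening u - closing v).
Proof.
  induction u as [|[|] u IH]; simpl; rewrite ?closing_app; weigh.
Qed.

Lemma same_matching_refl u : same_matching u u.
Proof. induction u; constructor; auto. Qed.

Lemma same_matching_sym {u v} : same_matching u v -> same_matching v u.
Proof. induction 1; constructor; auto. Qed.

Lemma same_matching_trans {u v w} :
  same_matching u v -> same_matching v w -> same_matching u w.
Proof.
  intros H; revert w; induction H; intros w Hw; inversion Hw; subst;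
    constructor; auto; congruence.
Qed.

Lemma same_matching_length {u v} : same_matching u v -> length u = length v.
Proof. induction 1; simpl; auto. Qed.

Lemma same_matching_unmatched {u v} : same_matching u v -> unmatched u = unmatched v.
Proof. destruct 1; auto. Qed.

Lemma same_weight_refl u : same_weight u u.
Proof. split; reflexivity. Qed.

Lemma same_weight_sym {u v} : same_weight u v -> same_weight v u.
Proof. intros []; split; auto. Qed.

Lemma same_weight_trans {u v w} : same_weight u v -> same_weight v w -> same_weight u w.
Proof. intros [] []; split; congruence. Qed.

Lemma same_weight_unmatched {u v} : same_weight u v -> unmatched u = unmatched v.
Proof. intros H. weigh. Qed.

Lemma same_weight_app {u u' v v'} :
  same_weight u u' -> same_weight v v' -> same_weight (u ++ v) (u' ++ v').
Proof. unfold same_weight. rewrite !closing_app, !opening_app. lia. Qed.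

(** Once the matched positions are known, the unmatched ones carry, from left to
    right, closing and then opening brackets, so their numbers fix the word. *)
Lemma same_matching_weight_eq {u v} : same_matching u v -> same_weight u v -> u = v.
Proof.
  induction 1 as [|s t u v H IH Hf]; intros Hw; auto.
  apply same_matching_unmatched in H.
  assert (s = t /\ same_weight u v) as [<- Hw'].
  { destruct s, t; weigh; repeat split; first [lia | exfalso; lia]. }
  f_equal; auto.
Qed.

Lemma same_matching_of_weight u i j :
  i + j = unmatched u -> exists v, same_matching u v /\ closing v = i /\ opening v = j.
Proof.
  revert i j; induction u as [|s u IH]; intros i j Hij.
  { exists []. unfold unmatched in Hij; simpl in Hij. split; [constructor|simpl; lia]. }
  assert (Hup : unmatched (s :: u) = S (unmatched u) \/
                s = Open /\ S (unmatched (s :: u)) = unmatched u).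
  { destruct s; weigh; right; split; [reflexivity|lia]. }
  destruct Hup as [Hup|[-> Hup]].
  - destruct i as [|i].
    + destruct (IH 0 (pred j)) as (v & Hv & Hc & Ho); [lia|].
      exists (Open :: v). split; [|weigh].
      constructor; auto. rewrite <- Hij. weigh.
    + destruct (IH i j) as (v & Hv & Hc & Ho); [lia|].
      exists (Close :: v). split; [|weigh].
      constructor; auto. rewrite <- Hij. weigh.
  - destruct (IH (S i) j) as (v & Hv & Hc & Ho); [lia|].
    exists (Open :: v). split; [|weigh].
    constructor; auto. rewrite <- Hij. weigh.
Qed.

(** The unmatched positions of [u] can be refilled with any number of closing
    brackets followed by opening ones without creating a new match. *)
Lemma same_matching_weight_exists {u w} :
  unmatched u = unmatched w -> exists v, same_matching u v /\ same_weight v w.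
Proof.
  intros H. destruct (same_matching_of_weight u (closing w) (opening w)) as (v & ? & ? & ?).
  - now rewrite H.
  - exists v. now repeat split.
Qed.

(** A match inside [u] does not depend on what follows. Numerically: suppose that
    the first bracket is matched inside the left factor in one word, but only across
    the cut in the other, and consider what follows it in the left factors. In the
    latter word all unmatched brackets of that part are opening and are matched
    across the cut; in the former one of equally many is closing. So the numbers of
    matches across the cut would differ, although they are determined by the numbers
    of unmatched brackets. *)
Lemma same_matching_app_inv {u u' v v'} :
  length u = length u' -> same_matching (u ++ v) (u' ++ v') ->
  same_matching u u' /\ same_matching v v'.
Proof.
  revert u'; induction u as [|s u IH]; intros [|s' u'] Hl H; try discriminate Hl.
  - split; [constructor|exact H].
  - simpl in H. inversion H; subst.
    destruct (IH u') as [Hu Hv]; auto.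
    split; auto. constructor; auto.
    apply same_matching_unmatched in Hu, Hv.
    assert (Ht : unmatched (u ++ v) = unmatched (u' ++ v'))
      by now apply same_matching_unmatched.
    change (s :: u ++ v) with ((s :: u) ++ v) in *.
    change (s' :: u' ++ v') with ((s' :: u') ++ v') in *.
    unfold unmatched in *. rewrite !closing_app, !opening_app in *.
    destruct s, s'; weigh.
Qed.

Lemma same_matching_split {w u v} :
  same_matching (u ++ v) w ->
  exists u' v', w = u' ++ v' /\ same_matching u u' /\ same_matching v v'.
Proof.
  intros H.
  assert (Hl := same_matching_length H). rewrite length_app in Hl.
  exists (firstn (length u) w), (skipn (length u) w).
  rewrite firstn_skipn. split; [reflexivity|].
  apply same_matching_app_inv; [|now rewrite firstn_skipn].
  rewrite length_firstn. lia.
Qed.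

(** With the matched positions prescribed on both halves and on the whole, the
    number of matches across the cut is known, and the total weight then
    determines the weights of the halves: either every [Open] of the left half
    or every [Close] of the right half is used up, and the number of closing
    brackets in the total tells which. *)
Lemma same_weight_app_inv {u v u2 v2 u' v' u2' v2'} :
  same_weight u u2 -> same_weight v v2 ->
  same_matching (u ++ v) (u' ++ v') -> same_matching (u2 ++ v2) (u2' ++ v2') ->
  length u = length u' -> length u2 = length u2' ->
  same_weight (u' ++ v') (u2' ++ v2') -> same_weight u' u2' /\ same_weight v' v2'.
Proof.
  intros Hu Hv H H2 Hl Hl2 Hw.
  destruct (same_matching_app_inv Hl H) as [Mu Mv].
  destruct (same_matching_app_inv Hl2 H2) as [Mu2 Mv2].
  apply same_matching_unmatched in H, H2, Mu, Mv, Mu2, Mv2.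
  unfold same_weight, unmatched in *. rewrite !closing_app, !opening_app in *. lia.
Qed.

Definition flip (s : bracket) := match s with Open => Close | Close => Open end.

(** Reading a word backwards with the two brackets exchanged keeps all matches; this
    symmetry of the category reverses the tensor product. *)
Definition mirror (u : word) : word := rev (map flip u).

Lemma mirror_app u v : mirror (u ++ v) = mirror v ++ mirror u.
Proof. unfold mirror. now rewrite map_app, rev_app_distr. Qed.

Lemma mirror_involutive u : mirror (mirror u) = u.
Proof.
  unfold mirror. rewrite map_rev, rev_involutive, map_map.
  rewrite <- (map_id u) at 2. apply map_ext. now intros [].
Qed.

Lemma length_mirror u : length (mirror u) = length u.
Proof. unfold mirror. now rewrite length_rev, length_map. Qed.

Lemma weight_mirror u : closing (mirror u) = opening u /\ opening (mirror u) = closing u.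
Proof.
  induction u as [|s u [IHc IHo]]; [split; reflexivity|].
  change (s :: u) with ([s] ++ u).
  rewrite mirror_app, !closing_app, !opening_app, IHc, IHo.
  destruct s; simpl; lia.
Qed.

Lemma same_weight_mirror {u v} : same_weight u v -> same_weight (mirror u) (mirror v).
Proof.
  unfold same_weight. destruct (weight_mirror u) as [-> ->], (weight_mirror v) as [-> ->]. lia.
Qed.

Lemma unmatched_mirror u : unmatched (mirror u) = unmatched u.
Proof. unfold unmatched. destruct (weight_mirror u) as [-> ->]. lia. Qed.

Lemma same_matching_mirror {u v} : same_matching u v -> same_matching (mirror u) (mirror v).
Proof.
  revert v; induction u as [|s u IH] using rev_ind; intros v H.
  - inversion H; constructor.
  - destruct (same_matching_split H) as (v' & t & -> & Hv & Ht).
    inversion Ht as [|? t' ? w Hnil]; subst. inversion Hnil; subst.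
    rewrite !mirror_app. simpl. constructor; auto.
    change (unmatched (mirror [s] ++ mirror u) = unmatched (mirror [t'] ++ mirror v')).
    rewrite <- !mirror_app, !unmatched_mirror. now apply same_matching_unmatched.
Qed.

(** * The monoidal category of bracket words *)

(** Words with the same matched positions form one irreducible component, in which
    a word is determined by its weight. Stability says that a relation does not
    look at individual words: it relates whole components with equally many
    unmatched brackets, and does so by the unique bijection preserving weights. *)
Record crystal_map (m n : nat) := {
  rel :> word -> word -> Prop;
  rel_length : forall u v, rel u v -> length u = m /\ length v = n;
  rel_weight : forall u v, rel u v -> same_weight u v;
  rel_stable : forall u v u' v', rel u v ->
    same_matching u u' -> same_matching v v' -> same_weight u' v' -> rel u' v'
}.
Arguments rel_length {m n} _ {u v} _.
Arguments rel_weight {m n} _ {u v} _.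
Arguments rel_stable {m n} _ {u v u' v'} _ _ _ _.

Lemma crystal_map_ext {m n} (f g : crystal_map m n) :
  (forall u v, f u v <-> g u v) -> f = g.
Proof.
  intros H.
  assert (E : rel m n f = rel m n g).
  { do 2 (apply functional_extensionality; intros ?).
    apply propositional_extensionality, H. }
  destruct f as [f f1 f2 f3], g as [g g1 g2 g3]. simpl in E. subst g.
  f_equal; apply proof_irrelevance.
Qed.

(** The identity relation. All structural isomorphisms of the category have this
    form; in general the lengths on both sides are equal but not convertible. *)
Definition relabel {m n} (e : m = n) : crystal_map m n.
Proof.
  refine {| rel := fun u v => u = v /\ length u = m |}.
  - intros u v [<- <-]. now rewrite <- e.
  - intros u v [<- _]. apply same_weight_refl.
  - intros u v u' v' [<- <-] Hu Hv Hw. split.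
    + apply same_matching_weight_eq; auto.
      eapply same_matching_trans; [apply same_matching_sym|]; eassumption.
    + symmetry. now apply same_matching_length.
Defined.

Definition compose {m n p} (g : crystal_map n p) (f : crystal_map m n) :
  crystal_map m p.
Proof.
  refine {| rel := fun u w => exists v, f u v /\ g v w |}.
  - intros u w (v & Hf & Hg).
    split; [apply (rel_length f Hf)|apply (rel_length g Hg)].
  - intros u w (v & Hf & Hg).
    eapply same_weight_trans; [apply (rel_weight f Hf)|apply (rel_weight g Hg)].
  - intros u w u' w' (v & Hf & Hg) Hu Hw Huw.
    destruct (@same_matching_weight_exists v u') as (v' & Hv & Hvu).
    { rewrite <- (same_matching_unmatched Hu). symmetry.
      apply same_weight_unmatched, (rel_weight f Hf). }
    exists v'. split.
    + apply (rel_stable f Hf); auto. now apply same_weight_sym.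
    + apply (rel_stable g Hg); auto. eapply same_weight_trans; eassumption.
Defined.

Definition juxtapose {m m' n n'} (f : crystal_map m m') (g : crystal_map n n') :
  crystal_map (m + n) (m' + n').
Proof.
  refine {| rel := fun w w' => exists u v u' v',
              w = u ++ v /\ w' = u' ++ v' /\ f u u' /\ g v v' |}.
  - intros w w' (u & v & u' & v' & -> & -> & Hf & Hg).
    destruct (rel_length f Hf), (rel_length g Hg).
    rewrite !length_app. lia.
  - intros w w' (u & v & u' & v' & -> & -> & Hf & Hg).
    apply same_weight_app; [apply (rel_weight f Hf)|apply (rel_weight g Hg)].
  - intros w w' x x' (u & v & u' & v' & -> & -> & Hf & Hg) Hx Hx' Hw.
    destruct (same_matching_split Hx) as (p & q & -> & Hp & Hq).
    destruct (same_matching_split Hx') as (p' & q' & -> & Hp' & Hq').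
    destruct (same_weight_app_inv (rel_weight f Hf) (rel_weight g Hg) Hx Hx')
      as [Wp Wq]; auto using same_matching_length.
    exists p, q, p', q'. repeat split.
    + apply (rel_stable f Hf); auto.
    + apply (rel_stable g Hg); auto.
Defined.

Definition Crystal : Category.
Proof.
  refine {| ob := nat; hom := crystal_map;
            id := fun n => relabel eq_refl;
            comp := fun m n p g f => compose g f |}.
  - intros m n f. apply crystal_map_ext; intros u v; simpl. split.
    + now intros (? & ? & <- & ?).
    + intros H. exists v. repeat split; auto. apply (rel_length f H).
  - intros m n f. apply crystal_map_ext; intros u v; simpl. split.
    + now intros (? & (<- & ?) & ?).
    + intros H. exists u. repeat split; auto. apply (rel_length f H).
  - intros m n p q h g f. apply crystal_map_ext; intros u v; simpl. firstorder.
Defined.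

Definition relabel_iso {m n : Crystal} (e : m = n) : Iso m n.
Proof.
  refine {| iso_hom := relabel e : @hom Crystal m n;
            iso_inv := relabel (eq_sym e) : @hom Crystal n m |};
  destruct e; apply crystal_map_ext; intros u v; simpl; split;
  [intros (? & [<- ?] & [<- ?])|intros [<- ?]; exists u|
   intros (? & [<- ?] & [<- ?])|intros [<- ?]; exists u]; auto.
Defined.

Lemma app_eq_split {A} {u u' v v' : list A} :
  length u = length u' -> u ++ v = u' ++ v' -> u = u' /\ v = v'.
Proof.
  revert u'; induction u as [|a u IH]; intros [|b u'] Hl H; try discriminate; auto.
  injection H as <- H. destruct (IH u') as [-> ->]; auto.
Qed.

Lemma compose_relabel_l {m n p} (e : n = p) (f : crystal_map m n) u v :
  compose (relabel e) f u v <-> f u v.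
Proof.
  simpl. split.
  - now intros (? & ? & <- & _).
  - intros H. exists v. repeat split; auto. apply (rel_length f H).
Qed.

Lemma compose_relabel_r {m n p} (e : m = n) (f : crystal_map n p) u v :
  compose f (relabel e) u v <-> f u v.
Proof.
  simpl. split.
  - now intros (? & (<- & _) & ?).
  - intros H. exists u. repeat split; auto. rewrite e. apply (rel_length f H).
Qed.

Lemma juxtapose_relabel {m m' n n'} (e : m = m') (e' : n = n') :
  juxtapose (relabel e) (relabel e') = relabel (f_equal2 Nat.add e e').
Proof.
  apply crystal_map_ext; intros w w'; simpl. split.
  - intros (u & v & u' & v' & -> & -> & [<- <-] & [<- <-]).
    now rewrite length_app.
  - intros [<- Hl]. exists (firstn m w), (skipn m w), (firstn m w), (skipn m w).
    rewrite firstn_skipn, length_firstn, length_skipn. repeat split; lia.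
Qed.

Lemma compose_relabel {m n p} (e : m = n) (e' : n = p) :
  compose (relabel e') (relabel e) = relabel (eq_trans e e').
Proof. apply crystal_map_ext; intros u v. exact (compose_relabel_l e' (relabel e) u v). Qed.

Lemma compose_juxtapose {m m' m'' n n' n''} (f' : crystal_map m' m'')
    (f : crystal_map m m') (g' : crystal_map n' n'') (g : crystal_map n n') :
  juxtapose (compose f' f) (compose g' g) =
  compose (juxtapose f' g') (juxtapose f g).
Proof.
  apply crystal_map_ext; intros w w'; simpl. split.
  - intros (u & v & u' & v' & -> & -> & (x & Hf & Hf') & (y & Hg & Hg')).
    exists (x ++ y). split; [exists u, v, x, y|exists x, y, u', v']; auto.
  - intros (z & (u & v & x & y & -> & -> & Hf & Hg) &
            (x' & y' & u' & v' & E & -> & Hf' & Hg')).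
    destruct (rel_length f Hf) as [_ Hx], (rel_length f' Hf') as [Hx' _].
    apply app_eq_split in E; [|congruence]. destruct E as [<- <-].
    exists u, v, u', v'. repeat split; eauto.
Qed.

Lemma juxtapose_assoc {m m' n n' p p'} (f : crystal_map m m')
    (g : crystal_map n n') (h : crystal_map p p') w w' :
  juxtapose (juxtapose f g) h w w' <-> juxtapose f (juxtapose g h) w w'.
Proof.
  simpl. split.
  - intros (? & x & ? & x' & -> & -> & (u & v & u' & v' & -> & -> & Hf & Hg) & Hh).
    rewrite <- !app_assoc. exists u, (v ++ x), u', (v' ++ x').
    repeat split; auto. exists v, x, v', x'. auto.
  - intros (u & ? & u' & ? & -> & -> & Hf & v & x & v' & x' & -> & -> & Hg & Hh).
    rewrite !app_assoc. exists (u ++ v), x, (u' ++ v'), x'.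
    repeat split; auto. exists u, v, u', v'. auto.
Qed.

Lemma juxtapose_unit_l {m n} (e : 0 = 0) (f : crystal_map m n) w w' :
  juxtapose (relabel e) f w w' <-> f w w'.
Proof.
  simpl. split.
  - now intros ([|] & v & ? & v' & -> & -> & [<- Hl] & Hf).
  - intros Hf. now exists [], w, [], w'.
Qed.

Lemma juxtapose_unit_r {m n} (e : 0 = 0) (f : crystal_map m n) w w' :
  juxtapose f (relabel e) w w' <-> f w w'.
Proof.
  simpl. split.
  - intros (v & [|] & v' & ? & -> & -> & Hf & [<- Hl]); [|discriminate].
    now rewrite !app_nil_r.
  - intros Hf. exists w, [], w', []. now rewrite !app_nil_r.
Qed.

Definition CrystalMonoidal : MonoidalCategory.
Proof.
  refine {| carrier := Crystal;
            tensor_ob := fun m n : Crystal => m + n : Crystal;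
            tensor_hom := fun m m' n n' f g => juxtapose f g;
            one := 0 : Crystal;
            assoc := fun m n p =>
              relabel_iso (eq_sym (Nat.add_assoc m n p));
            lunit := fun m => relabel_iso (eq_refl m);
            runit := fun m => relabel_iso (Nat.add_0_r m) |}; simpl.
  - intros m n. rewrite juxtapose_relabel. now apply crystal_map_ext.
  - intros. apply compose_juxtapose.
  - intros. apply crystal_map_ext; intros w w'.
    rewrite compose_relabel_l, compose_relabel_r. apply juxtapose_assoc.
  - intros. apply crystal_map_ext; intros w w'.
    rewrite compose_relabel_l, compose_relabel_r. apply juxtapose_unit_l.
  - intros. apply crystal_map_ext; intros w w'.
    rewrite compose_relabel_l, compose_relabel_r. apply juxtapose_unit_r.
  - intros. rewrite !juxtapose_relabel, compose_relabel. now apply crystal_map_ext.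
  - intros. rewrite !juxtapose_relabel, !compose_relabel. now apply crystal_map_ext.
Defined.

(** * Adjoints of the tensor functors *)

(** The action of [x ⊗ -] on morphisms, for the object [x] of words of length one. *)
Definition prefix {m n} (f : crystal_map m n) : crystal_map (S m) (S n) :=
  juxtapose (relabel (eq_refl 1)) f.

Lemma prefixE {m n} (f : crystal_map m n) w w' :
  prefix f w w' <->
  exists s u u', w = s :: u /\ w' = s :: u' /\ f u u'.
Proof.
  simpl. split.
  - intros ([|s []] & v & ? & v' & -> & -> & [<- Hl] & Hf); try discriminate.
    now exists s, v, v'.
  - intros (s & u & u' & -> & -> & Hf). now exists [s], u, [s], u'.
Qed.

(** The unit of the self-adjunction. The words [s :: t :: v'] with [v'] in the
    component of [v] fall into components along the two-step walks of the number of
    unmatched brackets that start at [k = unmatched v]; equality of weights selects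
    the walks that return to [k], and one word for each. *)
Definition insert_pair (n : nat) : crystal_map n (S (S n)).
Proof.
  refine {| rel := fun v w => length v = n /\ same_weight v w /\
              exists s t v', w = s :: t :: v' /\ same_matching v v' |}.
  - intros v w (<- & _ & s & t & v' & -> & Hv).
    simpl. now rewrite (same_matching_length Hv).
  - intros v w (_ & Hw & _). exact Hw.
  - intros v w v1 w1 (<- & Hw & s & t & v' & -> & Hv) Hv1 Hw1 Hw'.
    repeat split; try apply Hw'.
    + symmetry. now apply same_matching_length.
    + inversion Hw1 as [|? s1 ? w2 H2]; subst.
      inversion H2 as [|? t1 ? v2 H3]; subst.
      exists s1, t1, v2. split; auto.
      eauto using same_matching_sym, same_matching_trans.
Defined.

(** Converse relations make the category self-dual, compatibly with [prefix], so
    each statement on the unit yields one on the counit. *)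
Definition transpose {m n} (f : crystal_map m n) : crystal_map n m.
Proof.
  refine {| rel := fun u v => f v u |}.
  - intros u v H. destruct (rel_length f H); auto.
  - intros u v H. apply same_weight_sym, (rel_weight f H).
  - intros u v u' v' H Hu Hv Hw. apply (rel_stable f H); auto using same_weight_sym.
Defined.

Definition delete_pair (n : nat) : crystal_map (S (S n)) n :=
  transpose (insert_pair n).

Lemma same_weight_cons s {u v} : same_weight u v -> same_weight (s :: u) (s :: v).
Proof. intros H. apply (same_weight_app (same_weight_refl [s]) H). Qed.

Lemma transpose_involutive {m n} (f : crystal_map m n) : transpose (transpose f) = f.
Proof. now apply crystal_map_ext. Qed.

Lemma transpose_compose {m n p} (g : crystal_map n p) (f : crystal_map m n) :
  transpose (compose g f) = compose (transpose f) (transpose g).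
Proof. apply crystal_map_ext; intros u v; simpl. firstorder. Qed.

Lemma transpose_prefix {m n} (f : crystal_map m n) :
  transpose (prefix f) = prefix (transpose f).
Proof.
  apply crystal_map_ext; intros u v. rewrite prefixE.
  change (transpose (prefix f) u v) with (prefix f v u).
  rewrite prefixE. simpl. firstorder.
Qed.

Lemma transpose_relabel {n} : transpose (relabel (eq_refl n)) = relabel (eq_refl n).
Proof.
  apply crystal_map_ext; intros u v; simpl. split; intros [<- H]; auto.
Qed.

(** [f] relates components as wholes, so it does not matter whether the component
    is changed by [f] before or after two brackets are put in front. *)
Lemma insert_pair_natural {m n} (f : crystal_map m n) :
  compose (insert_pair n) f = compose (prefix (prefix f)) (insert_pair m).
Proof.
  apply crystal_map_ext; intros v x. split.
  - intros (w & Hf & Hl & Hx & s & t & w' & -> & Hw).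
    destruct (rel_length f Hf) as [Hm _]. pose proof (rel_weight f Hf) as Hvw.
    destruct (@same_matching_weight_exists v w') as (v' & Hv & Hvw').
    { rewrite <- (same_matching_unmatched Hw). now apply same_weight_unmatched. }
    exists (s :: t :: v'). split.
    + repeat split; auto; [| |exists s, t, v'; auto];
        apply (same_weight_trans Hvw), (same_weight_trans Hx),
          same_weight_sym, same_weight_cons, same_weight_cons, Hvw'.
    + apply prefixE. exists s, (t :: v'), (t :: w'). repeat split.
      apply prefixE. exists t, v', w'. repeat split.
      apply (rel_stable f Hf); auto.
  - intros (z & (Hl & Hz & s & t & v' & -> & Hv) & H).
    apply prefixE in H as (s1 & y & y' & E & -> & H).
    apply prefixE in H as (t1 & v1 & w' & -> & -> & Hf).
    injection E as <- <- <-. pose proof (rel_weight f Hf) as Hvw'.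
    destruct (@same_matching_weight_exists w' v) as (w & Hw & Hwv).
    { rewrite <- (same_weight_unmatched Hvw'). symmetry. now apply same_matching_unmatched. }
    assert (f v w) as Hvw.
    { apply (rel_stable f Hf); auto using same_matching_sym, same_weight_sym. }
    exists w. split; auto.
    repeat split; [apply (rel_length f Hvw)| | |exists s, t, w';
      auto using same_matching_sym];
      apply (same_weight_trans Hwv), (same_weight_trans Hz),
        same_weight_cons, same_weight_cons, Hvw'.
Qed.

Lemma delete_pair_natural {m n} (f : crystal_map m n) :
  compose (delete_pair n) (prefix (prefix f)) = compose f (delete_pair m).
Proof.
  rewrite <- (transpose_involutive f). generalize (transpose f) as g. intros g.
  unfold delete_pair.
  now rewrite <- !transpose_prefix, <- !transpose_compose, insert_pair_natural.
Qed.

(** One of the two pairs inserts a walk whose first step is the step made by [t]: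
    a pair that matches itself steps up first, and a pair [Close], [Open] whose
    second bracket is matched in [v] steps down first. *)
Lemma same_weight_insert_pair t v : exists s s',
  same_weight v (s :: s' :: v) /\ same_matching (t :: v) (s' :: v).
Proof.
  destruct (Nat.eq_dec (unmatched (t :: v)) (S (unmatched v))) as [H|H].
  - exists Open, Close. split; [weigh|].
    constructor; [apply same_matching_refl|]. rewrite H. weigh.
  - exists Close, Open. destruct t; [|exfalso; apply H; weigh].
    split; [|apply same_matching_refl].
    weigh.
Qed.

(** Inserting a return walk before the last step [t] and then deleting a return
    walk at the end leaves the first inserted step, which must go where [t] went;
    the weight identifies the word. *)
Lemma delete_pair_prefix_insert_pair n :
  compose (delete_pair (S n)) (prefix (insert_pair n)) = relabel (eq_refl (S n)).
Proof.
  apply crystal_map_ext; intros x y. split.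
  - intros (z & H & Hy & Hyz & t' & s1 & v1 & E & Hm).
    apply prefixE in H as (t & v & w & -> & -> & Hl & Hvw & s & s' & v' & -> & Hv).
    injection E as <- <- <-.
    assert (t :: v = y) as <-; [|split; simpl; auto].
    apply same_matching_weight_eq.
    + inversion Hm as [|t' ? w ? Hw Hf]; subst. constructor.
      * eauto using same_matching_sym, same_matching_trans.
      * rewrite (same_weight_unmatched Hyz). apply same_weight_unmatched, same_weight_cons, Hvw.
    + apply (same_weight_trans (same_weight_cons t Hvw)), same_weight_sym, Hyz.
  - intros [<- Hl]. destruct x as [|t v]; [discriminate|]. injection Hl as Hl.
    destruct (same_weight_insert_pair t v) as (s & s' & Hw & Hm).
    exists (t :: s :: s' :: v). split.
    + apply prefixE. exists t, v, (s :: s' :: v). repeat split; auto.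
      all: try apply Hw. exists s, s', v. auto using same_matching_refl.
    + repeat split; simpl; auto; try apply (same_weight_cons t Hw).
      exists t, s, (s' :: v). auto.
Qed.

Lemma prefix_delete_pair_insert_pair n :
  compose (prefix (delete_pair n)) (insert_pair (S n)) = relabel (eq_refl (S n)).
Proof.
  unfold delete_pair. rewrite <- transpose_prefix.
  rewrite <- (transpose_involutive (insert_pair (S n))), <- transpose_compose.
  change (transpose (insert_pair (S n))) with (delete_pair (S n)).
  now rewrite delete_pair_prefix_insert_pair, transpose_relabel.
Qed.

Definition letter : CrystalMonoidal := 1.

Lemma tensor_left_letter_adjoint :
  left_adjoint_to (tensor_left letter) (tensor_left letter).
Proof.
  apply left_adjoint_toE. exists insert_pair, delete_pair.
  split; [|split; [|split]]; intros.
  - apply insert_pair_natural.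
  - apply delete_pair_natural.
  - apply delete_pair_prefix_insert_pair.
  - apply prefix_delete_pair_insert_pair.
Qed.

Definition mirror_map {m n} (f : crystal_map m n) : crystal_map m n.
Proof.
  refine {| rel := fun u v => f (mirror u) (mirror v) |}.
  - intros u v H. rewrite <- (length_mirror u), <- (length_mirror v).
    apply (rel_length f H).
  - intros u v H. apply (rel_weight f), same_weight_mirror in H.
    now rewrite !mirror_involutive in H.
  - intros u v u' v' H Hu Hv Hw.
    apply (rel_stable f H); auto using same_matching_mirror, same_weight_mirror.
Defined.

Lemma mirror_map_relabel {n} :
  mirror_map (relabel (eq_refl n)) = relabel (eq_refl n).
Proof.
  apply crystal_map_ext; intros u v; simpl. rewrite length_mirror. split.
  - intros [E H]. split; auto.
    now rewrite <- (mirror_involutive u), E, mirror_involutive.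
  - now intros [<- H].
Qed.

Lemma mirror_map_compose {m n p} (g : crystal_map n p) (f : crystal_map m n) :
  mirror_map (compose g f) = compose (mirror_map g) (mirror_map f).
Proof.
  apply crystal_map_ext; intros u w; simpl. split.
  - intros (v & Hf & Hg). exists (mirror v). now rewrite mirror_involutive.
  - intros (v & Hf & Hg). now exists (mirror v).
Qed.

Definition mirror_functor : Functor Crystal Crystal :=
  {| fob := fun n : Crystal => n;
     fmap := @mirror_map : forall m n : Crystal, hom m n -> hom m n;
     fmap_id := @mirror_map_relabel; fmap_comp := @mirror_map_compose |}.

Lemma mirror_map_involutive {m n} (f : crystal_map m n) :
  mirror_map (mirror_map f) = f.
Proof.
  apply crystal_map_ext; intros u v; simpl. now rewrite !mirror_involutive.
Qed.

(** An involution is inverse, hence adjoint, to itself. *)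
Lemma mirror_self_adjoint : left_adjoint_to mirror_functor mirror_functor.
Proof.
  apply left_adjoint_toE. exists (fun n => id n), (fun n => id n).
  repeat split; simpl; intros;
    rewrite ?mirror_map_involutive, ?mirror_map_relabel; apply crystal_map_ext;
    intros u v; now rewrite compose_relabel_l, ?compose_relabel_r.
Qed.

Lemma mirror_map_prefix {m n} (f : crystal_map m n) u v :
  mirror_map (prefix (mirror_map f)) u v <-> juxtapose f (relabel (eq_refl 1)) u v.
Proof.
  etransitivity; [apply prefixE|]. simpl. split.
  - intros (s & p & q & Hu & Hv & Hf).
    exists (mirror p), (mirror [s]), (mirror q), (mirror [s]).
    rewrite <- !mirror_app. simpl. rewrite <- Hu, <- Hv, !mirror_involutive. auto.
  - intros (p & [|s []] & q & ? & -> & -> & Hf & <- & Hl); try discriminate.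
    exists (flip s), (mirror p), (mirror q).
    now rewrite !mirror_app, !mirror_involutive.
Qed.

(** [- ⊗ x] is [x ⊗ -] conjugated by the mirror symmetry. *)
Lemma tensor_right_letter_adjoint :
  left_adjoint_to (tensor_right letter) (tensor_right letter).
Proof.
  pose (suffix_functor :=
          functor_comp mirror_functor (functor_comp (tensor_left letter) mirror_functor)).
  pose (e := fun n : Crystal => relabel_iso (eq_sym (Nat.add_1_r n))).
  assert (N : forall (m n : Crystal) (f : hom m n),
            iso_hom (e n) ∘ fmap suffix_functor f =
            fmap (tensor_right letter) f ∘ iso_hom (e m)).
  { intros m n f. apply crystal_map_ext; intros u v.
    etransitivity; [apply compose_relabel_l|].
    etransitivity; [apply mirror_map_prefix|].
    symmetry; apply compose_relabel_r. }
  exact (@left_adjoint_to_iso _ _ suffix_functor (tensor_right letter)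
           (functor_comp (functor_comp mirror_functor (tensor_left letter)) mirror_functor)
           (tensor_right letter) e e N N
           (left_adjoint_to_comp
              (left_adjoint_to_comp mirror_self_adjoint tensor_left_letter_adjoint)
              mirror_self_adjoint)).
Qed.

Lemma crystal_tensor_representable : tensor_representable CrystalMonoidal.
Proof.
  split; intros n; induction n as [|n [n' IH]].
  - exists one. apply tensor_right_one_adjoint.
  - exists (n' ⊗ letter).
    exact (tensor_right_tensor_adjoint tensor_right_letter_adjoint IH).
  - exists one. apply tensor_left_one_adjoint.
  - exists (n' ⊗ letter).
    exact (tensor_left_tensor_adjoint tensor_left_letter_adjoint IH).
Qed.

(** The first snake identity fails for every candidate [n] for the right dual: the
    coevaluation would produce a word [c'] without unmatched brackets, and the
    evaluation would leave its last bracket, which must be the [Open] that was fed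
    in. But a final [Open] is never matched. *)
Lemma crystal_not_rigid : ~ rigid CrystalMonoidal.
Proof.
  intros H. destruct (H letter) as [_ (n & ev & coev & Hsnake & _)].
  assert (E := f_equal (fun g : crystal_map 1 1 => g [Open] [Open]) Hsnake).
  assert (Hid := eq_ind_r (fun P => P) (conj eq_refl eq_refl) E : rel _ _ _ [Open] [Open]).
  destruct Hid as (u1 & [<- _] & u2 & H2 & u3 & [<- _] & u4 & H4 & -> & _).
  destruct H2 as (p & c & p' & c' & Ep & -> & [<- Hp] & Hc).
  destruct H4 as (d & q & d' & q' & Ed & Eq & Hd & [<- Hq]).
  destruct (rel_length ev Hd) as [_ Hd'], (rel_length coev Hc) as [Hcl Hcl'].
  destruct (rel_weight coev Hc) as [_ Ho].
  destruct d'; [|discriminate]. destruct c; [|discriminate]. simpl in Eq. subst q.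
  destruct c' as [|t c' _] using rev_ind.
  { simpl in Hcl'. change (0 = n + 1) in Hcl'. lia. }
  rewrite app_assoc in Ed. apply app_inj_tail in Ed as [_ ->].
  rewrite opening_app in Ho. simpl in Ho. lia.
Qed.

Theorem theorem3p23 :
  exists C : MonoidalCategory, tensor_representable C /\ ~ rigid C.
Proof.
  exists CrystalMonoidal.
  exact (conj crystal_tensor_representable crystal_not_rigid).
Qed.
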